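(* Let $G=(V(G),E(G),w)$ be a connected graph with weight function $w:E(G)\to\mathbb{R}_+$, and let $D$ be a DFS tree of $G$. Then $\mathrm{mac}(G)\ge \frac{w(G)}{2}+\frac{w(D)}{4}$.
   Context: $\mathbb{R}_+$ denotes the non-negative reals; for a subgraph $H$, $w(H)=\sum_{e\in E(H)}w(e)$. $\mathrm{mac}(G)$ is the maximum total weight of the edges between $A$ and $B$ over all partitions $(A,B)$ of $V(G)$. A DFS tree is a spanning tree produced by depth-first search: choose a root $r$, start with $D=\{r\}$ and $r$ active; at each step, if the active vertex $u$ has a neighbor $v\notin V(D)$, add $v$ and the edge $uv$ to $D$, set $\mathrm{back}(v)=u$ and make $v$ active; otherwise make $\mathrm{back}(u)$ active; stop when $D$ contains all vertices of $G$. *)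

(* Defs.v *)
From mathcomp Require Import all_boot all_order all_algebra.
From mathcomp Require Import reals.

Set Implicit Arguments.
Unset Strict Implicit.
Unset Printing Implicit Defensive.

Import Order.TTheory GRing.Theory Num.Theory.
Local Open Scope ring_scope.

Record sgraph (V : finType) := SGraph {
  adj : rel V;
  adj_sym : symmetric adj;
  adj_irrefl : irreflexive adj
}.

(* An edge is the 2-element set of its end vertices. *)
Definition edges (V : finType) (G : sgraph V) : {set {set V}} :=
  [set [set p.1; p.2] | p : V * V & adj G p.1 p.2].

Definition graph_connected (V : finType) (G : sgraph V) : Prop :=
  forall x y : V, connect (adj G) x y.

(* Weight of the subgraph with edge set E. Weight functions are total on
   {set V}; only their values on edges are ever used. *)
Definition weight (R : realType) (V : finType) (w : {set V} -> R)
    (E : {set {set V}}) : R :=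
  \sum_(e in E) w e.

Definition cut_edges (V : finType) (G : sgraph V) (A B : {set V}) :
    {set {set V}} :=
  [set e in edges G | [exists x in A, [exists y in B, e == [set x; y]]]].

(* A partition of V is (A, ~: A), with empty parts allowed. The default value 0
   of the maximum is attained, by A = set0. *)
Definition mac (R : realType) (V : finType) (G : sgraph V)
    (w : {set V} -> R) : R :=
  \big[Num.max/0]_(A : {set V}) weight w (cut_edges G A (~: A)).

(* A state of depth-first search: V(D), E(D), the partial function back and the
   active vertex. *)
Record dfs_state (V : finType) := DfsState {
  dfs_verts : {set V};
  dfs_edges : {set {set V}};
  dfs_back : V -> option V;
  dfs_active : V
}.

Definition dfs_init (V : finType) (r : V) : dfs_state V :=
  DfsState [set r] set0 (fun=> None) r.

(* The premise S != setT is the stopping rule: no step is made once D contains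
   all vertices. *)
Inductive dfs_step (V : finType) (G : sgraph V) :
    dfs_state V -> dfs_state V -> Prop :=
| DfsAdvance S E back u v :
    S != setT -> adj G u v -> v \notin S ->
    dfs_step G (DfsState S E back u)
      (DfsState (v |: S) ([set u; v] |: E) [eta back with v |-> Some u] v)
| DfsBacktrack S E back u p :
    S != setT -> (forall v, adj G u v -> v \in S) -> back u = Some p ->
    dfs_step G (DfsState S E back u) (DfsState S E back p).

Inductive dfs_reachable (V : finType) (G : sgraph V) (r : V) :
    dfs_state V -> Prop :=
| DfsStart : dfs_reachable G r (dfs_init r)
| DfsNext s t :
    dfs_reachable G r s -> dfs_step G s t -> dfs_reachable G r t.

(* A DFS tree spans all vertices, so it is represented by its edge set. *)
Definition is_dfs_tree (V : finType) (G : sgraph V) (D : {set {set V}}) :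
    Prop :=
  exists r s, [/\ dfs_reachable G r s, dfs_verts s = setT & dfs_edges s = D].

(* Main.v *)
Require Import Defs.
From mathcomp Require Import all_boot all_order all_algebra.
From mathcomp Require Import reals lra.

Set Implicit Arguments.
Unset Strict Implicit.
Unset Printing Implicit Defensive.

Import Order.TTheory GRing.Theory Num.Theory.
Local Open Scope ring_scope.

(** In a DFS tree, two children of the same vertex are never adjacent in G: when
the later one was discovered, the earlier one had already been left for good,
with all its neighbours visited. So the stars formed by the vertices of even
depth and their children are induced subgraphs of G, and likewise for odd depth.
Choose independently and uniformly one of the two 2-colourings of each star: all
edges inside stars are cut, and every other edge is cut with probability 1/2.
Hence [mac G >= w(G)/2 + w(star edges)/2]. Every edge of D lies in a star for
one of the two parities, so averaging the two bounds gives the result. *)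

Lemma edgesP (V : finType) (G : sgraph V) (e : {set V}) :
  reflect (exists x y, adj G x y /\ e = [set x; y]) (e \in edges G).
Proof.
apply: (iffP imsetP) => [[[x y]]|[x [y [xy ->]]]]; last first.
  by exists (x, y); rewrite ?inE.
by rewrite inE /= => xy ->; exists x, y.
Qed.

Lemma mem_cut_edges (V : finType) (G : sgraph V) (A : {set V}) (x y : V) :
  adj G x y ->
  ([set x; y] \in cut_edges G A (~: A)) = (x \in A) (+) (y \in A).
Proof.
move=> xy; rewrite inE.
have -> /= : [set x; y] \in edges G by apply/edgesP; exists x, y.
apply/exists_inP/idP => [[a aA /exists_inP[b]]|].
  rewrite inE => bA /eqP E.
  have aE : a \in [set x; y] by rewrite E set21.
  have bE : b \in [set x; y] by rewrite E set22.
  by move: aA bA; case/set2P: aE => ->; case/set2P: bE => -> -> // /negPf->.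
case xA : (x \in A) => /= yA.
  by exists x => //; apply/exists_inP; exists y; rewrite ?inE.
exists y => //; apply/exists_inP; exists x; rewrite ?inE ?xA //.
by rewrite setUC.
Qed.

Section ClusterCut.
Variables (R : realType) (V : finType) (G : sgraph V) (w : {set V} -> R).

Lemma weight_le_mac (A : {set V}) : weight w (cut_edges G A (~: A)) <= mac G w.
Proof.
exact: (le_bigmax _ (fun B => weight w (cut_edges G B (~: B))) A).
Qed.

(** [c x] names the cluster of [x]; [s] is one fixed 2-colouring, proper inside every cluster. *)
Variables (c : V -> V) (s : V -> bool).
Hypothesis s_proper : forall x y, adj G x y -> c x = c y -> s x != s y.

Definition cluster_edges : {set {set V}} :=
  [set e in edges G | [forall x in e, forall y in e, c x == c y]].

Lemma mem_cluster_edges x y : adj G x y ->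
  ([set x; y] \in cluster_edges) = (c x == c y).
Proof.
move=> xy; rewrite inE.
have -> /= : [set x; y] \in edges G by apply/edgesP; exists x, y.
apply/forall_inP/eqP => [/(_ x (set21 _ _))/forall_inP|cxy a].
  by move=> /(_ y (set22 _ _))/eqP.
move=> axy; apply/forall_inP => b.
by move: axy; do 2!case/set2P=> ->; rewrite ?cxy.
Qed.

(** [f] holds one coin per cluster name, deciding whether the colours [s] are swapped on that
    cluster. *)
Definition cluster_side (f : {ffun V -> bool}) : {set V} :=
  [set v | f (c v) (+) s v].

(** The ends of an edge inside a cluster share a coin, so [s_proper] makes every [f] cut it. The
    ends of any other edge have separate coins, so half of the [f] cut it. *)
Lemma card_cluster_cut (e : {set V}) : e \in edges G ->
  2 * (\sum_(f : {ffun V -> bool})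
         (e \in cut_edges G (cluster_side f) (~: cluster_side f))%:R) =
  #|{ffun V -> bool}|%:R * (1 + (e \in cluster_edges)%:R) :> R.
Proof.
case/edgesP=> x [y [xy ->]]; rewrite mem_cluster_edges //.
under eq_bigr do rewrite mem_cut_edges // !inE.
case: eqVneq => [cxy|cxy].
  under eq_bigr => f _.
    rewrite cxy; have -> : f (c y) (+) s x (+) (f (c y) (+) s y).
      by have := s_proper xy cxy; case: (f _) (s x) (s y) => -[] [].
    over.
  by rewrite sumr_const /= mulrC; congr (_ * _); rewrite -natrD.
(* Toggling only the coin of [c x] moves [x] to the other side and leaves [y] in place, so exactly
   one of [f] and [flip f] cuts the edge. *)
pose flip (f : {ffun V -> bool}) : {ffun V -> bool} :=
  [ffun z => f z (+) (z == c x)].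
have flipK : involutive flip by move=> f; apply/ffunP=> z; rewrite !ffunE addbK.
rewrite mulr_natl mulr2n {1}(reindex_inj (inv_inj flipK)) -big_split /=.
rewrite addr0 mulr1 -[RHS]sumr_const; apply: eq_bigr => f _.
rewrite !ffunE eqxx [c y == _]eq_sym (negPf cxy).
by case: (f (c x)) (f (c y)) (s x) (s y) => -[] [] [] /=; rewrite ?addr0 ?add0r.
Qed.

Lemma mac_clusters :
  weight w (edges G) / 2 + weight w cluster_edges / 2 <= mac G w.
Proof.
set N : R := #|{ffun V -> bool}|%:R.
have N_gt0 : 0 < N by rewrite ltr0n; apply/card_gt0P; exists [ffun=> false].
have weight_sub (E : {set {set V}}) : E \subset edges G ->
    weight w E = \sum_(e in edges G) w e * (e \in E)%:R.
  move=> EG; rewrite /weight [RHS](big_setID E) /= (setIidPr EG).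
  rewrite [X in _ = _ + X]big1 ?addr0 => [|e /setDP[_ /negPf->]].
    by apply: eq_bigr => e ->; rewrite mulr1.
  by rewrite mulr0.
have sub_edges (P : pred {set V}) : [set e in edges G | P e] \subset edges G.
  by apply/subsetP=> e; rewrite inE => /andP[].
(* The mean cut weight over all [f] is at most the maximum; exchanging the sums reduces it to the
   count for each edge. *)
have : \sum_(f : {ffun V -> bool})
    weight w (cut_edges G (cluster_side f) (~: cluster_side f)) <= N * mac G w.
  rewrite /N mulr_natl -sumr_const; apply: ler_sum => f _.
  exact: weight_le_mac.
under eq_bigr do rewrite weight_sub ?sub_edges //.
rewrite exchange_big /=.
under eq_bigr do rewrite -mulr_sumr.
move=> le_sum.
rewrite -(ler_pM2l N_gt0); apply: le_trans le_sum.
rewrite (weight_sub cluster_edges) ?sub_edges // /weight.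
rewrite -mulrDl -big_split mulrA mulr_sumr mulr_suml /=.
apply: ler_sum => e eG.
have := card_cluster_cut eG; rewrite -/N => cut_e.
suff -> : N * (w e + w e * (e \in cluster_edges)%:R) / 2 =
  w e * \sum_(f : {ffun V -> bool})
         (e \in cut_edges G (cluster_side f) (~: cluster_side f))%:R by [].
rewrite -[X in X + _]mulr1 -mulrDr mulrCA -cut_e.
by rewrite -mulrA [2 * _]mulrC mulfK ?pnatr_eq0.
Qed.

End ClusterCut.

(* [T] is the vertex set of the tree path from the root to the active vertex;
it meets each depth [d] at most once. *)
Record dfs_invariant (V : finType) (G : sgraph V) (s : dfs_state V)
    (d : V -> nat) (T : {set V}) : Prop := DfsInvariant {
  inv_sub : T \subset dfs_verts s;
  inv_active : dfs_active s \in T;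
  inv_inj : {in T &, injective d};
  inv_max : forall x, x \in T -> (d x <= d (dfs_active s))%N;
  inv_up : forall x p, x \in T -> dfs_back s x = Some p -> p \in T;
  inv_done : forall x y,
    x \in dfs_verts s -> x \notin T -> adj G x y -> y \in dfs_verts s;
  inv_back : forall x p, dfs_back s x = Some p ->
    [/\ x \in dfs_verts s, p \in dfs_verts s, adj G p x & d x = (d p).+1];
  inv_edges : forall e, e \in dfs_edges s ->
    exists x p, dfs_back s x = Some p /\ e = [set p; x];
  inv_siblings : forall x y p,
    dfs_back s x = Some p -> dfs_back s y = Some p -> ~~ adj G x y
}.

(** An advance puts [v] on the path one level below [u]. A backtrack takes [u] off the path when all
    its neighbours are visited, as [inv_done] requires. *)
Lemma dfs_step_invariant (V : finType) (G : sgraph V) (s s' : dfs_state V)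
    (d : V -> nat) (T : {set V}) :
  dfs_step G s s' -> dfs_invariant G s d T ->
  exists d' T', dfs_invariant G s' d' T'.
Proof.
case=> [S E back u v _ uv vS|S E back u p _ uS up] [/=].
  move=> TS uT inj max up fin bk ed sib.
  have nv x : x \in S -> (x == v) = false.
    by move=> xS; apply/eqP=> xv; rewrite -xv xS in vS.
  have nvT x : x \in T -> (x == v) = false by move/(subsetP TS)/nv.
  (* An earlier child [x] of [u] is deeper than the active vertex, so it is off the path and all its
     neighbours are visited, unlike [v]. *)
  have v_sib x : back x = Some u -> ~~ adj G x v.
    move=> xu; have [xS _ _ dx] := bk _ _ xu; apply: contra vS => xv.
    apply: fin xv => //; apply/negP => /max; rewrite dx.
    by rewrite ltnn.
  have uS := subsetP TS _ uT.
  exists [eta d with v |-> (d u).+1], (v |: T); split => /=.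
  - exact: setUS.
  - exact: setU11.
  - move=> x y /setU1P[->|xT] /setU1P[->|yT] //=; rewrite ?eqxx ?nvT //.
    + by move=> E1; have := max _ yT; rewrite -E1 ltnn.
    + by move=> E1; have := max _ xT; rewrite E1 ltnn.
    + exact: inj.
  - move=> x /setU1P[->|xT]; rewrite ?eqxx ?nvT //.
    exact: leqW (max _ xT).
  - move=> x q /setU1P[->|xT]; rewrite ?eqxx ?nvT //.
      by case=> <-; rewrite setU1r.
    by move=> /(up _ _ xT) qT; rewrite setU1r.
  - move=> x y /setU1P[->|xS]; first by rewrite setU11.
    by rewrite !inE (nv _ xS) /= => xT xy; rewrite (fin x) ?orbT.
  - move=> x q; case: eqP => [->|_].
      by case=> <-; rewrite setU11 (setU1r _ uS) nv.
    by case/bk=> xS qS qx dx; rewrite !setU1r // nv.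
  - move=> e /setU1P[->|/ed[x [q [xq ->]]]].
      by exists v, u; rewrite eqxx.
    by exists x, q; case: (bk _ _ xq) => xS _ _ _; rewrite nv.
  - move=> x y q; case: eqP => [->|_]; case: eqP => [->|_].
    + by rewrite adj_irrefl.
    + by case=> <- /v_sib; rewrite adj_sym.
    + by move=> + [qu]; rewrite -qu => /v_sib.
    + exact: sib.
move=> TS uT inj max upT fin bk ed sib.
have [_ _ _ du] := bk _ _ up.
have ne_d x y : d x != d y -> x != y by apply: contraNneq => ->.
exists d, (T :\ u); split => //=.
- exact: subset_trans (subsetDl _ _) TS.
- by rewrite !inE (upT u) // andbT ne_d // du neq_ltn leqnn.
- by move=> x y /setD1P[_ xT] /setD1P[_ yT]; apply: inj.
(* Depths on the path are distinct, so all its vertices but [u] have depth below [d u], that is, at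
   most [d p]. *)
- move=> x /setD1P[xu xT]; rewrite -ltnS -du ltn_neqAle max // andbT.
  by apply: contraNneq xu => dxu; apply/eqP; apply: inj.
- move=> x q /setD1P[xu xT] xq; rewrite !inE (upT x) // andbT ne_d //.
  by have [_ _ _ dx] := bk _ _ xq; have := max _ xT; rewrite dx ltn_neqAle => /andP[].
- move=> x y xS; rewrite !inE negb_and negbK => /orP[/eqP->|xT].
    exact: uS.
  exact: fin.
Qed.

Lemma dfs_reachable_invariant (V : finType) (G : sgraph V) (r : V)
    (s : dfs_state V) :
  dfs_reachable G r s -> exists d T, dfs_invariant G s d T.
Proof.
elim=> {s} [|s t _ [d [T inv]] step]; last exact: dfs_step_invariant step inv.
exists (fun=> 0%N), [set r]; split => //=; rewrite ?set11 //.
- by move=> x y /set1P-> /set1P->.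
- by move=> x y ->.
- by move=> e; rewrite inE.
Qed.

Theorem theorem3p1 (R : realType) (V : finType) (G : sgraph V)
    (w : {set V} -> R) (w_ge0 : forall e, e \in edges G -> 0 <= w e)
    (G_connected : graph_connected G)
    (D : {set {set V}}) (D_dfs : is_dfs_tree G D) :
  mac G w >= weight w (edges G) / 2 + weight w D / 4.
Proof.
case: D_dfs => r [s [/dfs_reachable_invariant[d [T inv]] _ <-]].
pose par v := odd (d v).
(* Stars centred at parity [i]: a centre names its own star, and any other vertex takes its parent's
   name. A vertex of the other parity without a parent, such as the root, stands alone. *)
pose c i v := if par v == i then v else odflt v (dfs_back s v).
have par_back x p : dfs_back s x = Some p -> par x = ~~ par p.
  by case/(inv_back inv) => _ _ _; rewrite /par => ->.
(* Depth parity is the 2-colouring of the stars: two distinct vertices of equal parity in one star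
   would be siblings, hence not adjacent. *)
have par_proper i x y : adj G x y -> c i x = c i y -> par x != par y.
  move=> xy cxy; apply/negP => /eqP pxy; move: cxy; rewrite /c -pxy.
  have xNy : x <> y by move=> E; rewrite E adj_irrefl in xy.
  case: eqP => // _.
  case xp : (dfs_back s x) => [p|]; case yq : (dfs_back s y) => [q|] //= E.
  - by have := inv_siblings inv xp; rewrite E => /(_ _ yq); rewrite xy.
  - by move: pxy; rewrite (par_back _ _ xp) E => /esym; case: (par y).
  - by move: pxy; rewrite (par_back _ _ yq) E; case: (par q).
have le_star : weight w (dfs_edges s) <=
    weight w (cluster_edges G (c true)) + weight w (cluster_edges G (c false)).
  rewrite /weight (bigID (mem (cluster_edges G (c true)))) /=.
  have sum_sub (A : {set {set V}}) (P : pred {set V}) :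
      A \subset edges G -> {subset P <= A} -> \sum_(e | P e) w e <= \sum_(e in A) w e.
    move=> AG PA; rewrite [leRHS](bigID P) /=.
    rewrite (eq_bigl (fun e => (e \in A) && P e)); last first.
      by move=> e; case Pe: (P e); rewrite ?andbF // andbT PA.
    rewrite lerDl; apply: sumr_ge0 => e /andP[/(subsetP AG) eG _].
    exact: w_ge0.
  have cluster_sub i : cluster_edges G (c i) \subset edges G.
    by apply/subsetP=> e; rewrite inE => /andP[].
  apply: lerD; apply: sum_sub => // e /andP[] //.
  (* Both ends of a tree edge are sent to the parent [p] by [c (par p)], so an edge missed by
     [c true] is covered by [c false]. *)
  move=> /(inv_edges inv)[x [p [xp ->]]]; have [_ _ px _] := inv_back inv xp.
  rewrite !mem_cluster_edges // /c (par_back _ _ xp) xp.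
  by case: (par p); rewrite /= ?eqxx.
have le_true := mac_clusters w (par_proper true).
have le_false := mac_clusters w (par_proper false).
lra.
Qed.
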